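(* Let $q=p^{\alpha}$, where $p\equiv 1 \pmod 8$ is a prime and $\alpha$ is a positive integer. Let $G^\ast(q)$ be the Peisert-like graph of order $q$. Let $\chi_4$ be a Dirichlet character mod $q$ of order $4$, and let $\varphi$ and $\varepsilon$ be the quadratic and trivial characters mod $q$, respectively. Then the number $k_4(G^\ast(q))$ of cliques of order $4$ in $G^\ast(q)$ is $$k_4(G^\ast(q))=\frac{p^{2\alpha-1}(p-1)}{3072}\left[2 p^{2\alpha-2}(p^2-20p+81)+2\,(\mathrm{Im}\,\rho)^2+4\, \mathrm{Im}(\rho)\cdot \mathrm{Im}(\xi)-\mathrm{Re}(M_3)+3M_5\right],$$ where $\rho:=J(\chi_4,\chi_4)$, $\xi:=J(\chi_4,\varphi)$, $$M_3= q^2\cdot{_{3}}F_{2}\left(\begin{array}{ccc}\chi_4, & \overline{\chi_4}, & \overline{\chi_4}\\ & \varphi, & \varepsilon\end{array}\Big| 1\right)\quad\text{and}\quad M_5= q^2\cdot{_{3}}F_{2}\left(\begin{array}{ccc}\chi_4, & \chi_4, & \overline{\chi_4}\\ & \varepsilon, & \varepsilon\end{array}\Big| 1\right).$$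
   Context: Peisert-like graph: let $q=p^\alpha$ with $p\equiv 1\pmod 8$ prime and $\alpha\ge 1$. Let $\mathbb{Z}_q=\mathbb{Z}/q\mathbb{Z}$, with cyclic unit group $\mathbb{Z}_q^\ast=\langle g\rangle$ for a fixed generator $g$. $G^\ast(q)$ is the simple undirected graph with vertex set $\mathbb{Z}_q$ in which $xy$ is an edge if and only if $x-y\in\langle g^4\rangle\cup g\langle g^4\rangle$ (well defined since $-1\in\langle g^4\rangle$; different generators give isomorphic graphs). $k_m(G)$ is the number of cliques of order $m$ in $G$ ($m$-element sets of pairwise adjacent vertices). Characters: Dirichlet characters mod $q$ are regarded as functions $\mathbb{Z}_q\to\mathbb{C}$ vanishing on non-units (including the trivial character $\varepsilon$, which is $1$ on $\mathbb{Z}_q^\ast$ and $0$ elsewhere). They form a group $\widehat{\mathbb{Z}_q^\ast}$ under pointwise multiplication, and $\overline{\psi}(a)=\overline{\psi(a)}$. The quadratic character is $\varphi=\chi_4^2$. The Jacobi sum is $J(A,B):=\sum_{x\in\mathbb{Z}_q}A(x)B(1-x)$. Binomial coefficient: $\binom{A}{B}:=\frac{B(-1)}{q}J(A,\overline{B})$. Hypergeometric function: with $\phi$ the Euler totient function, for Dirichlet characters $A,B,C,D,E$ mod $q$ and $x\in\mathbb{Z}_q$, $${_{3}}F_{2}\left(\begin{array}{ccc}A,&B,&C\\&D,&E\end{array}\Big|x\right):=\frac{q}{\phi(q)}\sum_{\chi\in\widehat{\mathbb{Z}_q^\ast}}\binom{A\chi}{\chi}\binom{B\chi}{D\chi}\binom{C\chi}{E\chi}\chi(x).$$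 *)

(* Defs.v *)
From mathcomp Require Import all_boot all_order all_algebra all_fingroup.
From mathcomp Require Import all_solvable all_field all_character.

Set Implicit Arguments.
Unset Strict Implicit.
Unset Printing Implicit Defensive.

Import Order.TTheory GRing.Theory Num.Theory GroupScope.
Local Open Scope ring_scope.

(* All uses have 1 < q, so that 'Z_q is Z/qZ. *)
Definition Zunits (q : nat) : {group {unit 'Z_q}} := [set: {unit 'Z_q}]%G.

Definition num_cliques (T : finType) (e : rel T) (m : nat) : nat :=
  #|[set A : {set T} | (#|A| == m) &&
      [forall x in A, forall y in A, (x != y) ==> e x y]]|.

Definition peisert_like (q : nat) (g : {unit 'Z_q}) : rel 'Z_q :=
  fun x y =>
    x - y \in FinRing.uval @: (<[g ^+ 4]> :|: g *: <[g ^+ 4]>)%g.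

(* A Dirichlet character mod q is represented by a linear character of the
   unit group; its product, conjugate and order are those of class functions.
   Values are roots of unity, so algC can serve as the complex numbers. *)
Lemma irr_Zunits (q : nat) (chi : 'CF(Zunits q)) :
  (chi \in irr (Zunits q)) = (chi \is a linear_char).
Proof.
apply/idP/idP => [/irrP[i ->]|]; last exact: lin_char_irr.
by apply/char_abelianP/zmodp.units_Zp_abelian.
Qed.

Definition dirichlet (q : nat) (chi : 'CF(Zunits q)) (a : 'Z_q) : algC :=
  if insub a is Some u then chi u else 0.

Definition jacobi (q : nat) (A B : 'CF(Zunits q)) : algC :=
  \sum_(x : 'Z_q) dirichlet A x * dirichlet B (1 - x).

Definition char_binom (q : nat) (A B : 'CF(Zunits q)) : algC :=
  dirichlet B (-1) / q%:R * jacobi A (B^*)%CF.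

(* By irr_Zunits, 'chi_i runs once over each Dirichlet character mod q. *)
Definition hyp3F2 (q : nat) (A B C D E : 'CF(Zunits q)) (x : 'Z_q) : algC :=
  q%:R / (totient q)%:R *
  \sum_(i : Iirr (Zunits q))
    char_binom (A * 'chi_i) 'chi_i *
    char_binom (B * 'chi_i) (D * 'chi_i) *
    char_binom (C * 'chi_i) (E * 'chi_i) * dirichlet 'chi_i x.

(* Main.v *)
Require Import Defs.
From mathcomp Require Import all_boot all_order all_algebra all_fingroup.
From mathcomp Require Import all_solvable all_field all_character.
From mathcomp Require Import ring zify.

Import Order.TTheory GRing.Theory Num.Theory.
Local Open Scope ring_scope.

(** Let K = p^(alpha-1) and w = chi4(g), so that w^2 = -1.

    Reduction to a field.  The units of Z/q congruent to 1 mod p form a group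
    of order K, and K = 1 mod 4, so the quartic character chi4 is trivial on
    them ([chi4_kernel]): it comes from a quartic character chi of F_p
    ([dirichlet_modp]).  As the fibres of Z/q -> F_p have K elements, a sum
    over m variables in Z/q of a function of chi is K^m times the sum over F_p.

    From cliques to character sums.  The edge condition on u = x - y says that
    chi(u) is 1 or w, and its indicator is
      (2 + (1 - w) chi(u) + (1 + w) chi^3(u)) / 4 on nonzero u
    ([peisert_indicator]).  Hence 24 times the number of 4-cliques is K^4 times
    the sum over four points of F_p of the product of six such indicators.
    Translating one point to 0 and scaling another one to 1 leaves the points
    0, 1, b, c.  Expanding the product gives one term for each labelling of the
    six edges of K_4 by exponents 0, 1, 3; the scaling variable kills the terms
    whose exponents do not add up to 0 mod 4, and each other term is a sum
      sum_(b, c) chi^e1(b) chi^e2(c) chi^e3(1-b) chi^e4(1-c) chi^e5(b-c)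
    ([config_sum], [scaled_clique_sum]).

    Symmetry.  This is a sum over the configurations of five distinct points
    0, 1, oo, b, c of the projective line up to projective equivalence, so the
    symmetric group S_5 acts on the exponents without changing the value
    ([label_sum_orbit]).  The 183 labellings fall into 13 classes, and
    [class_weights] computes the total coefficient of each class.

    Evaluation.  In ten of the classes some representative has enough zero
    exponents for one variable to be summed out; their sums are polynomials in
    p, rho = J(chi, chi), xi = J(chi, chi^2) and their conjugates.  The other
    three are, up to the factor K^2, the number M5, the number M3 and its
    conjugate: orthogonality of characters turns a 3F2 at 1 into a double
    character sum ([hyp3F2_1]).  Finally rho = xi, because 2 is a square mod p
    and so chi(4) = 1 ([jacobi11_eq_jacobi12]), and rho times its conjugate is
    p ([norm_jacobi11]), which puts the total in the stated form. *)

(** * Counting cliques vertex by vertex *)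


Section Cliques.

Variables (T : finType) (e : rel T).
Hypotheses (e_sym : symmetric e) (e_irr : irreflexive e).

Definition cliques_in (S : {set T}) (m : nat) : {set {set T}} :=
  [set A : {set T} | [&& A \subset S, #|A| == m &
    [forall x in A, forall y in A, (x != y) ==> e x y]]].

Let nbhd x := [set y | e x y].

Lemma num_cliquesE m : num_cliques e m = #|cliques_in setT m|.
Proof. by apply: eq_card => A; rewrite !inE subsetT. Qed.

Lemma cliques_in0 (S : {set T}) : #|cliques_in S 0| = 1%N.
Proof.
rewrite -(cards1 (set0 : {set T})); apply: eq_card => A; rewrite !inE cards_eq0.
have [->|] := eqVneq A set0; last by rewrite andbF.
by rewrite sub0set; apply/forall_inP => x; rewrite inE.
Qed.

Lemma cliques_through (S : {set T}) x m : x \in S ->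
  #|[set A in cliques_in S m.+1 | x \in A]| = #|cliques_in (S :&: nbhd x) m|.
Proof.
move=> xS; rewrite -[RHS](card_in_imset (f := fun B => x |: B)); last first.
  move=> B C; rewrite !inE => /andP[/subsetP BS _] /andP[/subsetP CS _] E.
  have xB : x \notin B by apply/negP => /BS; rewrite !inE e_irr andbF.
  have xC : x \notin C by apply/negP => /CS; rewrite !inE e_irr andbF.
  by rewrite -(setU1K xB) -(setU1K xC) E.
apply: eq_card => A; apply/idP/imsetP => [|[B]].
  rewrite !inE => /andP[/and3P[/subsetP AS /eqP cA /forall_inP Ae] xA].
  exists (A :\ x); last by rewrite setD1K.
  rewrite !inE; apply/and3P; split.
  - apply/subsetP => y; rewrite !inE => /andP[yx yA]; rewrite AS //=.
    by have /forall_inP/(_ y yA) := Ae x xA; rewrite eq_sym yx.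
  - by have := cardsD1 x A; rewrite xA cA add1n => -[->].
  - apply/forall_inP => y; rewrite inE => /andP[_ yA]; apply/forall_inP => z.
    by rewrite inE => /andP[_ zA]; have /forall_inP/(_ z zA) := Ae y yA.
rewrite !inE => /and3P[/subsetP BS /eqP cB /forall_inP Be] ->.
have xB : x \notin B by apply/negP => /BS; rewrite !inE e_irr andbF.
rewrite setU11 andbT cardsU1 xB cB eqxx /=; apply/andP; split.
  by rewrite subUset sub1set xS; apply/subsetP => y /BS; rewrite inE => /andP[].
have xe y : y \in B -> e x y by move=> /BS; rewrite !inE => /andP[].
apply/forall_inP => y; rewrite !inE => /orP[/eqP->|yB]; apply/forall_inP => z.
  by rewrite !inE => /orP[/eqP->|/xe->]; rewrite ?eqxx ?implybT.
rewrite !inE => /orP[/eqP->|zB]; first by rewrite e_sym xe ?implybT.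
by have /forall_inP/(_ z zB) := Be y yB.
Qed.

(** Double count the pairs of a clique and one of its vertices x: removing x
    leaves a clique among the neighbours of x. *)
Lemma cliques_in_rec (S : {set T}) m :
  (m.+1 * #|cliques_in S m.+1| = \sum_(x in S) #|cliques_in (S :&: nbhd x) m|)%N.
Proof.
transitivity (\sum_(A in cliques_in S m.+1) \sum_(x in A) 1)%N.
  rewrite mulnC -sum_nat_const; apply: eq_bigr => A.
  by rewrite inE sum1_card => /and3P[_ /eqP->].
rewrite (exchange_big_dep (mem S)) => [|A x] /=; last first.
  by rewrite inE => /and3P[/subsetP AS _ _] /AS.
apply: eq_bigr => x xS; rewrite -cliques_through // -sum1_card.
by apply: eq_bigl => A; rewrite [in RHS]inE.
Qed.

Lemma sum_in_set (S : {set T}) (h : T -> nat) :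
  (\sum_(x in S) h x = \sum_x (x \in S) * h x)%N.
Proof.
by rewrite big_mkcond; apply: eq_bigr => x _; case: ifP; rewrite ?mul1n ?mul0n.
Qed.

Lemma num_cliques4 : (24 * num_cliques e 4 =
  \sum_x \sum_y \sum_u \sum_v
    e x y * e x u * e x v * e y u * e y v * e u v)%N.
Proof.
have c1 S : (1 * #|cliques_in S 1| = \sum_v (v \in S))%N.
  rewrite cliques_in_rec sum_in_set.
  by apply: eq_bigr => v _; rewrite cliques_in0 muln1.
have c2 S : (2 * #|cliques_in S 2| =
    \sum_u \sum_v (u \in S) * ((v \in S) * e u v))%N.
  rewrite cliques_in_rec sum_in_set; apply: eq_bigr => u _.
  rewrite -[#|_|]mul1n c1 big_distrr; apply: eq_bigr => v _ /=.
  by rewrite in_setI inE -mulnb.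
have c3 S : (6 * #|cliques_in S 3| = \sum_y \sum_u \sum_v
    (y \in S) * ((u \in S) * e y u * ((v \in S) * e y v * e u v)))%N.
  rewrite -[6%N]/(2 * 3)%N -mulnA cliques_in_rec sum_in_set big_distrr.
  apply: eq_bigr => y _ /=; rewrite mulnCA c2 !big_distrr; apply: eq_bigr => u _ /=.
  by rewrite big_distrr; apply: eq_bigr => v _ /=; rewrite !in_setI !inE -!mulnb.
rewrite num_cliquesE -[24%N]/(6 * 4)%N -mulnA cliques_in_rec sum_in_set big_distrr.
apply: eq_bigr => x _ /=; rewrite inE mul1n setTI c3.
apply: eq_bigr => y _; apply: eq_bigr => u _; apply: eq_bigr => v _.
rewrite !inE; ring.
Qed.

End Cliques.


(** * Exponent labels and their symmetries *)

(** A label [:: e1; e2; e3; e4; e5] lists the exponents of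
    b, c, 1 - b, 1 - c, b - c in a product of powers of a quartic character;
    they matter only mod 4, and 3 * e stands for - e. *)

Section Labels.

(** The four functions below describe how the exponents change when two of the
    points oo, 0, 1, c, b that are adjacent in this order are exchanged and the
    configuration is brought back to the form (0, 1, oo, b, c). *)
Definition swap_0oo (e : seq nat) : seq nat :=
  if e is [:: e1; e2; e3; e4; e5] then
    [:: 3 * (e1 + e3 + e5) %% 4; 3 * (e2 + e4 + e5) %% 4; e3; e4; e5]%N
  else e.
Definition swap_01 (e : seq nat) : seq nat :=
  if e is [:: e1; e2; e3; e4; e5] then [:: e3; e4; e1; e2; e5] else e.
Definition swap_1c (e : seq nat) : seq nat :=
  if e is [:: e1; e2; e3; e4; e5] then
    [:: e1; 3 * (e1 + e2 + e3 + e4 + e5) %% 4; e5; e4; e3]%N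
  else e.
Definition swap_bc (e : seq nat) : seq nat :=
  if e is [:: e1; e2; e3; e4; e5] then [:: e2; e1; e4; e3; e5] else e.

Definition swap (m : nat) : seq nat -> seq nat :=
  nth id [:: swap_0oo; swap_01; swap_1c; swap_bc] m.

(** The swaps are the Coxeter generators s_0, ..., s_3 of S_5, and every
    element of S_5 is uniquely a product u_0 u_1 u_2 u_3 in which u_k is a
    prefix, possibly empty, of s_k ... s_1 s_0.  So each element of S_5 is
    applied exactly once. *)
Definition label_orbit (e : seq nat) : seq (seq nat) :=
  foldl (fun es ms =>
      flatten [seq e' :: scanl (fun x m => swap m x) e' ms | e' <- es])
    [:: e] [:: [:: 0]; [:: 1; 0]; [:: 2; 1; 0]; [:: 3; 2; 1; 0]]%N.

(** In each class a label is chosen for which the sum is easy to evaluate or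
    is the one met in the hypergeometric functions.  The two members of a pair
    of complex conjugate classes are next to each other. *)
Definition class_reps : seq (seq nat) :=
  [:: [:: 0; 0; 0; 0; 0]; [:: 0; 0; 0; 0; 1]; [:: 0; 0; 0; 1; 0];
      [:: 0; 0; 0; 2; 1]; [:: 0; 0; 0; 2; 3]; [:: 0; 0; 1; 1; 0];
      [:: 0; 0; 1; 1; 1]; [:: 0; 0; 3; 3; 3]; [:: 0; 1; 1; 0; 1];
      [:: 0; 3; 3; 0; 3]; [:: 1; 1; 3; 3; 1]; [:: 3; 3; 1; 1; 3];
      [:: 1; 3; 3; 1; 1]]%N.

Definition class_rep (e : seq nat) : seq nat :=
  head e [seq r <- label_orbit e | r \in class_reps].

Fixpoint words (ks : seq nat) (m : nat) : seq (seq nat) :=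
  if m is m'.+1 then [seq k :: l | k <- ks, l <- words ks m'] else [:: [::]].

Lemma mem_words ks m l : l \in words ks m -> size l = m /\ all (mem ks) l.
Proof.
elim: m l => [|m IHm] l /=; first by rewrite inE => /eqP->.
by case/allpairsP => -[k l'] /= [k_ks /IHm[<- l'_ks] ->] /=; rewrite k_ks.
Qed.

Lemma prod_sum_words (A : comNzRingType) (I : Type) (G : nat -> I -> A) ks
    (s : seq I) :
  \prod_(i <- s) \sum_(k <- ks) G k i =
  \sum_(l <- words ks (size s)) \prod_(p <- zip l s) G p.1 p.2.
Proof.
elim: s => [|i s IHs] /=; first by rewrite big_nil big_seq1 big_nil.
rewrite big_cons IHs big_allpairs_dep mulr_suml; apply: eq_bigr => k _.
by rewrite mulr_sumr; apply: eq_bigr => l _; rewrite big_cons.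
Qed.

(** The labellings of the six edges that survive the summation over the scaling
    variable; the first letter is the exponent of the edge scaled to 1. *)
Definition balanced_words := [seq l <- words [:: 0; 1; 3] 6 | 4 %| sumn l]%N.

(** The product of the coefficients 2, 1 - w, 1 + w attached to the letters
    0, 1, 3.  It is an integer as (1 - w)(1 + w) = 2 and
    (1 - w)^4 = (1 + w)^4 = -4, and balance makes n1 - n3 a multiple of 4. *)
Definition word_weight (l : seq nat) : int :=
  let n1 := count_mem 1 l in let n3 := count_mem 3 l in
  (-1) ^+ (((n1 - n3) + (n3 - n1)) %/ 4) * 2%:R ^+ (6 - (n1 + n3)./2).

Definition weighted_classes : seq (int * seq nat) :=
  [seq (word_weight l, class_rep (behead l)) | l <- balanced_words].

Definition total_weight (ks : seq (int * seq nat)) (r : seq nat) : int :=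
  foldr +%R 0 [seq k.1 | k <- ks & k.2 == r].

Lemma class_weights :
  all (fun k => k.2 \in class_reps) weighted_classes /\
  map (total_weight weighted_classes) class_reps =
  [:: 64; 576; 864; 384; 384; 192; -192; -192; -48; -48; -16; -16; 96].
Proof. by split; vm_compute. Qed.

Lemma sum_total_weight (A : comNzRingType) (T : seq nat -> A) ks rs :
    uniq rs -> all (fun k => k.2 \in rs) ks ->
  \sum_(k <- ks) k.1%:~R * T k.2 = \sum_(r <- rs) (total_weight ks r)%:~R * T r.
Proof.
move=> rs_uniq /allP ks_rs.
transitivity (\sum_(k <- ks) \sum_(r <- rs | r == k.2) k.1%:~R * T r).
  apply: eq_big_seq => k /ks_rs k_rs; rewrite big_mkcond (bigD1_seq k.2) //= eqxx.
  by rewrite big1 ?addr0 // => r /negPf->.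
rewrite (exchange_big_dep predT) //=; apply: eq_bigr => r _.
rewrite -mulr_suml; congr (_ * _); rewrite /total_weight foldrE big_map big_filter.
by rewrite rmorph_sum; apply: eq_bigl => k; rewrite eq_sym.
Qed.

End Labels.

(** * Quartic character sums over a finite field *)

(** The element z is a primitive eighth root of unity of F; its existence says
    that #|F| = 1 mod 8, and it makes chi trivial on -1 and on 4. *)

Section QuarticSums.

Variables (F : finFieldType) (chi : F -> algC).
Hypothesis chiM : {morph chi : a b / a * b}.
Hypothesis chiX4 : forall a, a != 0 -> chi a ^+ 4 = 1.
Variable z : F.
Hypothesis z4 : z ^+ 4 = -1.
Hypothesis two_neq0 : 2%:R != 0 :> F.
Variable w : algC.
Hypothesis w2 : w ^+ 2 = -1.
Variable g : F.
Hypothesis chi_g : chi g = w.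

(** The Dirichlet character chi ^ k, extended by 0 at 0 also when k = 0. *)
Definition chipow (k : nat) (a : F) : algC :=
  if a == 0 then 0 else chi a ^+ k.

Local Notation X := chipow.
Local Notation n := (#|F|%:R : algC).

Lemma chi_neq0 a : a != 0 -> chi a != 0.
Proof.
move=> a0; apply/eqP=> E; have := chiX4 _ a0.
by rewrite E expr0n => /eqP; rewrite eq_sym oner_eq0.
Qed.

Lemma chi1 : chi 1 = 1.
Proof.
have := chiM 1 1; rewrite mulr1 -{1}[chi 1]mulr1 => /mulfI E.
by rewrite -E ?chi_neq0 ?oner_neq0.
Qed.

Lemma chipowM k a b : X k (a * b) = X k a * X k b.
Proof.
rewrite /X mulf_eq0; case: eqP => [_|_]; first by rewrite mul0r.
by case: eqP => _ /=; rewrite ?mulr0 // chiM exprMn.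
Qed.

Lemma chipowD k m a : X (k + m) a = X k a * X m a.
Proof. by rewrite /X; case: eqP; rewrite ?mul0r ?exprD. Qed.

Lemma chipow_absorb k a : X k a * X 0 a = X k a.
Proof. by rewrite -chipowD addn0. Qed.

Lemma chipow_mod k a : X (k %% 4) a = X k a.
Proof.
rewrite /X; case: eqP => // /eqP a0.
by rewrite [in RHS](divn_eq k 4) exprD mulnC exprM chiX4 // expr1n mul1r.
Qed.

Lemma chipow0 k : X k 0 = 0. Proof. by rewrite /X eqxx. Qed.
Lemma chipow1 k : X k 1 = 1.
Proof. by rewrite /X oner_eq0 chi1 expr1n. Qed.

Lemma z_neq0 : z != 0.
Proof.
apply/eqP => E; move: z4; rewrite E expr0n /= => /eqP.
by rewrite eq_sym oppr_eq0 oner_eq0.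
Qed.

Lemma chiN1 : chi (-1) = 1.
Proof.
by rewrite -z4 !exprS expr0 mulr1 !chiM -(chiX4 _ z_neq0) !exprS expr0 mulr1.
Qed.

Lemma chipowN k a : X k (- a) = X k a.
Proof. by rewrite -mulN1r chipowM /X oppr_eq0 oner_eq0 chiN1 expr1n mul1r. Qed.

Lemma chipowB k a b : X k (a - b) = X k (b - a).
Proof. by rewrite -chipowN opprB. Qed.

Lemma chi_cube a : a != 0 -> (chi a)^-1 = chi a ^+ 3.
Proof.
move=> a0; have c0 := chi_neq0 _ a0; apply: (mulfI c0).
by rewrite divff // -exprS chiX4.
Qed.

Lemma chipowV k a : X k a^-1 = X (3 * k) a.
Proof.
rewrite /X invr_eq0; case: eqP => // /eqP a0.
rewrite exprM -chi_cube //; congr (_ ^+ _).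
have c0 := chi_neq0 _ a0; apply: (mulfI c0).
by rewrite -chiM !divff // chi1.
Qed.

Lemma chipow_conj k a : (X k a)^* = X (3 * k) a.
Proof.
rewrite /X; case: eqP => [|/eqP a0]; first by rewrite rmorph0.
rewrite rmorphXn exprM -chi_cube //; congr (_ ^+ _).
have nm : `|chi a| = 1.
  by apply/eqP; rewrite -(@pexpr_eq1 _ _ 4) // -normrX chiX4 // normr1.
by rewrite [RHS]invC_norm nm expr1n invr1 mul1r.
Qed.

Lemma w_pow_neq1 k : ~~ (4 %| k)%N -> w ^+ k != 1.
Proof.
have w4 : w ^+ 4 = 1 by rewrite (exprM w 2 2) w2 sqrrN expr1n.
have two0 : (2%:R : algC) != 0 by rewrite pnatr_eq0.
rewrite /dvdn [X in w ^+ X](divn_eq k 4) exprD mulnC exprM w4 expr1n mul1r.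
have : (k %% 4 < 4)%N by rewrite ltn_pmod.
have N1 : (-1 : algC) != 1.
  by rewrite eq_sym -addr_eq0 -[1 + 1]/(2%:R).
have w1 : w != 1 by apply/eqP => E; move: N1; rewrite -w2 E expr1n eqxx.
case: (k %% 4)%N => [|[|[|[|]]]] //= _ _; first by rewrite w2.
rewrite exprS w2 mulrN1; apply/eqP => E.
by move: N1; rewrite -w2 -sqrrN E expr1n eqxx.
Qed.

Lemma g_neq0 : g != 0.
Proof.
(* multiplicativity at 0 would make w idempotent, while w ^+ 2 = -1 *)
apply/eqP => g0; have := chiM 0 0; rewrite mulr0 -g0 chi_g -expr2 w2 => E.
by have /w_pow_neq1 : ~~ (4 %| 2)%N by []; rewrite E sqrrN expr1n eqxx.
Qed.

Lemma sum_chipow k : ~~ (4 %| k)%N -> \sum_a X k a = 0.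
Proof.
move=> k4; have w1 := w_pow_neq1 _ k4.
have: \sum_a X k a = w ^+ k * \sum_a X k a.
  rewrite [LHS](reindex_inj (mulfI g_neq0)) mulr_sumr; apply: eq_bigr => a _.
  by rewrite chipowM /X (negPf g_neq0) chi_g.
move/eqP; rewrite -subr_eq0 -{1}[\sum_a _]mul1r -mulrBl mulf_eq0 subr_eq0.
by rewrite eq_sym (negPf w1) => /eqP.
Qed.

Lemma sum_chipow_sub k c : ~~ (4 %| k)%N -> \sum_b X k (b - c) = 0.
Proof.
move=> k4; rewrite (reindex_inj (addIr c)) /= -[RHS](sum_chipow k k4).
by apply: eq_bigr => b _; rewrite addrK.
Qed.

Lemma chipow_trivial a : X 0 a = 1 - (a == 0)%:R.
Proof. by rewrite /X; case: eqP; rewrite ?subrr ?subr0. Qed.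

Lemma chipow_trivial1 a : a != 0 -> X 0 a = 1.
Proof. by rewrite chipow_trivial => /negPf->; rewrite subr0. Qed.

Lemma sum_punctured c (h : F -> algC) :
  \sum_b X 0 (b - c) * h b = \sum_b h b - h c.
Proof.
rewrite (eq_bigr (fun b => h b - (b == c)%:R * h b)) => [|b _]; last first.
  by rewrite chipow_trivial subr_eq0 mulrBl mul1r.
rewrite sumrB [X in _ - X](bigD1 c) //= eqxx mul1r [X in h c + X]big1 ?addr0 //.
by move=> b /negPf->; rewrite mul0r.
Qed.

Lemma sum_const1 : \sum_(b : F) (1 : algC) = n.
Proof. by rewrite sumr_const. Qed.

(** The points b and c range freely, as the factors chi ^ e vanish unless
    0, 1, b and c are distinct. *)
Definition config_sum (e1 e2 e3 e4 e5 : nat) : algC :=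
  \sum_b \sum_c X e1 b * X e2 c * X e3 (1 - b) * X e4 (1 - c) * X e5 (b - c).

Definition jacobi11 := \sum_a X 1 a * X 1 (1 - a).
Definition jacobi12 := \sum_a X 1 a * X 2 (1 - a).

Lemma config_sum_swap_bc e1 e2 e3 e4 e5 :
  config_sum e1 e2 e3 e4 e5 = config_sum e2 e1 e4 e3 e5.
Proof.
rewrite /config_sum exchange_big; apply: eq_bigr => b _; apply: eq_bigr => c _.
by rewrite (chipowB _ c b); ring.
Qed.

Lemma config_sum_swap_01 e1 e2 e3 e4 e5 :
  config_sum e1 e2 e3 e4 e5 = config_sum e3 e4 e1 e2 e5.
Proof.
rewrite /config_sum (reindex_inj (inj_comp (addrI 1) oppr_inj)).
apply: eq_bigr => b _.
rewrite (reindex_inj (inj_comp (addrI 1) oppr_inj)); apply: eq_bigr => c _ /=.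
have -> : 1 - b - (1 - c) = c - b by ring.
by rewrite !subKr (chipowB _ c b); ring.
Qed.

(** The substitution b -> 1/b, c -> 1/c. *)
Lemma config_sum_swap_0oo e1 e2 e3 e4 e5 :
  config_sum e1 e2 e3 e4 e5 =
  config_sum (3 * (e1 + e3 + e5)) (3 * (e2 + e4 + e5)) e3 e4 e5.
Proof.
rewrite /config_sum (reindex_inj invr_inj); apply: eq_bigr => b _.
rewrite (reindex_inj invr_inj); apply: eq_bigr => c _ /=.
have [->|b0] := eqVneq b 0; first by rewrite invr0 !chipow0 !mul0r.
have [->|c0] := eqVneq c 0; first by rewrite invr0 !chipow0 !mulr0 !mul0r.
have -> : 1 - b^-1 = - (1 - b) * b^-1 by field.
have -> : 1 - c^-1 = - (1 - c) * c^-1 by field.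
have -> : b^-1 - c^-1 = - (b - c) * b^-1 * c^-1 by field; rewrite b0 c0.
rewrite !chipowM !chipowN !chipowV !mulnDr !chipowD; ring.
Qed.

(** The substitution b -> b/c, c -> 1/c. *)
Lemma config_sum_swap_1c e1 e2 e3 e4 e5 :
  config_sum e1 e2 e3 e4 e5 =
  config_sum e1 (3 * (e1 + e2 + e3 + e4 + e5)) e5 e4 e3.
Proof.
rewrite /config_sum exchange_big [RHS]exchange_big (reindex_inj invr_inj) /=.
apply: eq_bigr => c _.
have [->|c0] := eqVneq c 0.
  by rewrite invr0 !big1 // => b _; rewrite !chipow0 !mulr0 !mul0r.
have ci0 : c^-1 != 0 by rewrite invr_eq0.
rewrite (reindex_inj (mulIf ci0)); apply: eq_bigr => b _ /=.
have -> : 1 - b / c = - (b - c) * c^-1 by field.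
have -> : 1 - c^-1 = - (1 - c) * c^-1 by field.
have -> : b / c - c^-1 = - (1 - b) * c^-1 by field.
rewrite !chipowM !chipowN !chipowV !mulnDr !chipowD; ring.
Qed.

Lemma config_sum_mod e1 e2 e3 e4 e5 :
  config_sum (e1 %% 4) (e2 %% 4) (e3 %% 4) (e4 %% 4) (e5 %% 4) =
  config_sum e1 e2 e3 e4 e5.
Proof.
by apply: eq_bigr => b _; apply: eq_bigr => c _; rewrite !chipow_mod.
Qed.

Lemma config_sum_conj e1 e2 e3 e4 e5 :
  (config_sum e1 e2 e3 e4 e5)^* =
  config_sum (3 * e1) (3 * e2) (3 * e3) (3 * e4) (3 * e5).
Proof.
rewrite rmorph_sum; apply: eq_bigr => b _; rewrite rmorph_sum.
by apply: eq_bigr => c _; rewrite !rmorphM /= !chipow_conj.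
Qed.

Lemma sum_punctured2 c d (h : F -> algC) : c != d ->
  \sum_b X 0 (b - c) * X 0 (b - d) * h b = \sum_b h b - h c - h d.
Proof.
move=> cd; under eq_bigr do rewrite -mulrA.
rewrite !sum_punctured chipow_trivial1 ?subr_eq0 // mul1r.
by rewrite addrAC.
Qed.

Lemma sum_off01 (h : F -> algC) :
  \sum_b X 0 b * X 0 (1 - b) * h b = \sum_b h b - h 0 - h 1.
Proof.
rewrite -(sum_punctured2 0 1) ?[0 == 1]eq_sym ?oner_eq0 //.
by apply: eq_bigr => b _; rewrite subr0 (chipowB _ b).
Qed.

Lemma sum_off0 (h : F -> algC) : \sum_b X 0 b * h b = \sum_b h b - h 0.
Proof. by rewrite -(sum_punctured 0); apply: eq_bigr => b _; rewrite subr0. Qed.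

Lemma sum_off1 (h : F -> algC) : \sum_b X 0 (1 - b) * h b = \sum_b h b - h 1.
Proof. by rewrite -(sum_punctured 1); apply: eq_bigr => b _; rewrite chipowB. Qed.

Lemma sum_chipow_1sub k : ~~ (4 %| k)%N -> \sum_b X k (1 - b) = 0.
Proof. by move=> k4; under eq_bigr do rewrite chipowB; exact: sum_chipow_sub. Qed.

Lemma sum_off01_chipow_sub k c : ~~ (4 %| k)%N ->
  \sum_b X 0 b * X 0 (1 - b) * X k (b - c) = - X k c - X k (1 - c).
Proof.
by move=> k4; rewrite sum_off01 sum_chipow_sub // !sub0r chipowN.
Qed.

Lemma config_sum_00000 : config_sum 0 0 0 0 0 = (n - 2%:R) * (n - 3%:R).
Proof.
transitivity (\sum_c X 0 c * X 0 (1 - c) * (n - 3%:R)).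
  rewrite /config_sum exchange_big; apply: eq_bigr => c _.
  have [->|c0] := eqVneq c 0.
    by rewrite chipow0 !mul0r big1 // => b _; rewrite mulr0 !mul0r.
  have [->|c1] := eqVneq c 1.
    by rewrite subrr chipow0 mulr0 mul0r big1 // => b _; rewrite mulr0 !mul0r.
  rewrite (eq_bigr (fun b => X 0 c * X 0 (1 - c) *
    (X 0 b * X 0 (1 - b) * X 0 (b - c)))) => [|b _]; last by ring.
  rewrite -mulr_sumr; congr (_ * _); rewrite sum_off01.
  under eq_bigr do rewrite -[X 0 _]mulr1.
  rewrite sum_punctured sum_const1 sub0r chipowN.
  rewrite !chipow_trivial1 ?subr_eq0 // 1?eq_sym //; ring.
by rewrite sum_off01 -(mul1r (n - 3%:R)) -mulr_suml sum_const1; ring.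
Qed.

Lemma config_sum_000ek e k : ~~ (4 %| k)%N ->
  config_sum 0 0 0 e k =
  - (\sum_c X 0 c * (X e (1 - c) * X k c)) - \sum_c X 0 c * X (e + k) (1 - c).
Proof.
move=> k4; rewrite /config_sum exchange_big -sumrN -sumrB.
apply: eq_bigr => c _.
rewrite (eq_bigr (fun b => X 0 c * X e (1 - c) *
    (X 0 b * X 0 (1 - b) * X k (b - c)))) => [|b _]; last by ring.
rewrite -mulr_sumr sum_off01_chipow_sub // chipowD; ring.
Qed.

Lemma config_sum_00001 : config_sum 0 0 0 0 1 = 2%:R.
Proof.
rewrite config_sum_000ek // (eq_bigr (fun c => X 0 (1 - c) * X 1 c)) => [|c _].
  rewrite sum_off1 sum_off0 sum_chipow // sum_chipow_1sub // subr0 !chipow1; ring.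
by rewrite mulrCA -chipowD.
Qed.

Lemma config_sum_00021 : config_sum 0 0 0 2 1 = 1 - jacobi12.
Proof.
rewrite config_sum_000ek // (eq_bigr (fun c => X 1 c * X 2 (1 - c))) => [|c _].
  rewrite -/jacobi12 sum_off0 sum_chipow_1sub // subr0 chipow1; ring.
by rewrite mulrCA mulrC -chipowD.
Qed.

Lemma config_sum_00010 : config_sum 0 0 0 1 0 = - (n - 3%:R).
Proof.
transitivity (\sum_c (n - 3%:R) * (X 0 c * X 1 (1 - c))).
  rewrite /config_sum exchange_big; apply: eq_bigr => c _.
  have [->|c0] := eqVneq c 0.
    by rewrite chipow0 mul0r mulr0 big1 // => b _; rewrite mulr0 !mul0r.
  have [->|c1] := eqVneq c 1.
    by rewrite subrr chipow0 !mulr0 big1 // => b _; rewrite mulr0 !mul0r.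
  rewrite (eq_bigr (fun b => X 0 c * X 1 (1 - c) *
    (X 0 b * X 0 (1 - b) * X 0 (b - c)))) => [|b _]; last by ring.
  rewrite -mulr_sumr mulrC; congr (_ * _); rewrite sum_off01.
  under eq_bigr do rewrite -[X 0 _]mulr1.
  rewrite sum_punctured sum_const1 sub0r chipowN.
  rewrite !chipow_trivial1 ?subr_eq0 // 1?eq_sym //; ring.
rewrite -mulr_sumr sum_off0 sum_chipow_1sub // subr0 chipow1; ring.
Qed.

Lemma config_sum_00110 : config_sum 0 0 1 1 0 = 2%:R.
Proof.
transitivity (\sum_b X 0 b * (- X 1 (1 - b) - X 2 (1 - b))).
  apply: eq_bigr => b _.
  have [->|b0] := eqVneq b 0.
    by rewrite chipow0 mul0r big1 // => c _; rewrite !mul0r.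
  rewrite (eq_bigr (fun c => X 0 b * X 1 (1 - b) *
    (X 0 c * X 0 (c - b) * X 1 (1 - c)))) => [|c _]; last first.
    by rewrite (chipowB _ c); ring.
  rewrite -mulr_sumr -[2%N]/(1 + 1)%N chipowD -mulrA; congr (_ * _).
  rewrite (eq_bigr (fun c => X 0 (c - 0) * X 0 (c - b) * X 1 (1 - c))) => [|c _].
    by rewrite sum_punctured2 1?eq_sym // sum_chipow_1sub // subr0 chipow1; ring.
  by rewrite subr0.
rewrite sum_off0 sumrB sumrN !sum_chipow_1sub // !subr0 !chipow1; ring.
Qed.

(** The substitution b = 1 - (1 - c) t turns the sum into a Jacobi sum. *)
Lemma sum_jacobi_row c : c != 1 ->
  \sum_b X 1 (1 - b) * X 1 (b - c) = X 2 (1 - c) * jacobi11.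
Proof.
move=> c1; have c1' : 1 - c != 0 by rewrite subr_eq0 eq_sym.
rewrite (reindex_inj (inj_comp (addrI 1) (inj_comp oppr_inj (mulfI c1')))) /=.
rewrite /jacobi11 mulr_sumr; apply: eq_bigr => t _.
have -> : 1 - (1 - (1 - c) * t) = (1 - c) * t by ring.
have -> : 1 - (1 - c) * t - c = (1 - c) * (1 - t) by ring.
by rewrite !chipowM -[2%N]/(1 + 1)%N chipowD; ring.
Qed.

Lemma config_sum_00111 : config_sum 0 0 1 1 1 = - 2%:R * jacobi11.
Proof.
transitivity (\sum_c X 0 c * X 1 (1 - c) * (X 2 (1 - c) * jacobi11 - X 1 c)).
  rewrite /config_sum exchange_big; apply: eq_bigr => c _.
  rewrite (eq_bigr (fun b => X 0 c * X 1 (1 - c) *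
    (X 0 b * (X 1 (1 - b) * X 1 (b - c))))) => [|b _]; last by ring.
  rewrite -mulr_sumr; have [->|c1] := eqVneq c 1.
    by rewrite subrr !chipow0 !(mul0r, mulr0).
  by rewrite sum_off0 sum_jacobi_row // subr0 sub0r chipowN chipow1 mul1r.
rewrite (eq_bigr (fun c => X 0 c * (X 3 (1 - c)) * jacobi11 - X 1 c * X 1 (1 - c))).
  rewrite sumrB -mulr_suml -/jacobi11 sum_off0 sum_chipow_1sub // subr0 chipow1.
  ring.
by move=> c _; rewrite (chipowD 1 2) -[X 1 c in RHS]chipow_absorb; ring.
Qed.

Lemma config_sum_01101 : config_sum 0 1 1 0 1 = jacobi11 * jacobi12 + 1.
Proof.
transitivity (\sum_c X 1 c * X 0 (1 - c) * (X 2 (1 - c) * jacobi11 - X 1 c)).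
  rewrite /config_sum exchange_big; apply: eq_bigr => c _.
  rewrite (eq_bigr (fun b => X 1 c * X 0 (1 - c) *
    (X 0 b * (X 1 (1 - b) * X 1 (b - c))))) => [|b _]; last by ring.
  rewrite -mulr_sumr; have [->|c1] := eqVneq c 1.
    by rewrite subrr !chipow0 !(mul0r, mulr0).
  by rewrite sum_off0 sum_jacobi_row // subr0 sub0r chipowN chipow1 mul1r.
rewrite (eq_bigr (fun c => X 1 c * X 2 (1 - c) * jacobi11 - X 0 (1 - c) * X 2 c)).
  rewrite sumrB -mulr_suml -/jacobi12 sum_off1 sum_chipow // chipow1; ring.
by move=> c _; rewrite (chipowD 1 1 c) -[X 2 (1 - c) in RHS]chipow_absorb; ring.
Qed.

Lemma chipow2_sign v : v != 0 -> X 2 v = 1 \/ X 2 v = -1.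
Proof.
move=> v0; have /eqP: X 2 v ^+ 2 = 1 by rewrite /X (negPf v0) -exprM chiX4.
by rewrite sqrf_eq1 => /orP[]/eqP; [left | right].
Qed.

(** The difference of the two sides is nonnegative at every v: at a nonzero
    square both are 2, at a nonsquare the left one is 0, at 0 both are 1.  The
    differences add up to 0, so they all vanish. *)
Lemma card_sqrt v : \sum_(u | u ^+ 2 == v) (1 : algC) = 1 + X 2 v.
Proof.
pose d v := 1 + X 2 v - \sum_(u | u ^+ 2 == v) (1 : algC).
have d_ge0 b : true -> 0 <= d b.
  move=> _; rewrite /d; have [->|b0] := eqVneq b 0.
    rewrite (big_pred1 0) => [|u]; first by rewrite chipow0 addr0 subrr.
    by rewrite expf_eq0.
  have [u /eqP ub|no_u] := pickP (fun u => u ^+ 2 == b); last first.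
    rewrite big_pred0 // subr0; have [-> | ->] := chipow2_sign b b0.
      by rewrite -[1 + 1]/(2%:R) ler0n.
    by rewrite subrr.
  have u0 : u != 0 by apply: contra_neq b0 => u0; rewrite -ub u0 expr0n.
  have uN : - u != u.
    apply/eqP => E; have: 2%:R * u = 0 by rewrite mulr_natl mulr2n -{1}E addNr.
    by move/eqP; rewrite mulf_eq0 (negPf u0) (negPf two_neq0).
  rewrite (bigD1 u) ?ub //= (big_pred1 (- u)) => [|a].
    by rewrite -{1}ub expr2 chipowM -chipowD /X (negPf u0) chiX4 // subrr.
  rewrite -ub /= eqf_sqr; have [->|] := eqVneq a u; last by rewrite andbT.
  by rewrite andbF eq_sym (negPf uN).
have d0: \sum_b d b = 0.
  rewrite sumrB big_split /= sum_chipow // addr0 sum_const1.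
  rewrite (exchange_big_dep predT) //=.
  rewrite (eq_bigr (fun=> 1)) ?sum_const1 ?subrr // => u _.
  by rewrite (big_pred1 (u ^+ 2)) // => b; rewrite eq_sym.
have /eqP := d0; rewrite psumr_eq0 // => /allP/(_ v (mem_index_enum v)).
by move/implyP/(_ isT); rewrite subr_eq0 eq_sym => /eqP.
Qed.

(** With r = z + 1/z one has r^2 = 2, since z^2 + z^-2 = 0; so 4 = r^4. *)
Lemma chi_4 : chi 4%:R = 1.
Proof.
pose r := z + z^-1; have z0 := z_neq0.
have r2 : r ^+ 2 = 2%:R.
  have: z ^+ 2 * (r ^+ 2 - 2%:R) = z ^+ 4 + 1 by rewrite /r; field.
  rewrite z4 addNr => /eqP; rewrite mulf_eq0 expf_eq0 (negPf z0) /= subr_eq0.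
  by move/eqP.
have r0 : r != 0 by apply: contra_neq two_neq0 => r0; rewrite -r2 r0 expr0n.
have ->: 4%:R = r ^+ 4 by rewrite -[4%N]/(2 * 2)%N exprM r2; ring.
by rewrite -(chiX4 _ r0) !exprS expr0 !mulr1 !chiM.
Qed.

(** For a = (1 + u)/2 one has 4 a (1 - a) = 1 - u^2, so that the first sum is
    sum_u chi(1 - u^2); now group the u by the value of u^2. *)
Lemma jacobi11_eq_jacobi12 : jacobi11 = jacobi12.
Proof.
have u4 : (4%:R : F) != 0 by rewrite -[4%N]/(2 * 2)%N natrM mulf_neq0.
have X4 : X 1 4%:R = 1 by rewrite /X (negPf u4) chi_4.
have half_inj : injective (fun u : F => (1 + u) / 2%:R).
  by move=> u v /(mulIf (invr_neq0 two_neq0)) /addrI.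
rewrite /jacobi11 (reindex_inj half_inj) /=.
transitivity (\sum_u X 1 (1 - u ^+ 2)).
  apply: eq_bigr => u _; rewrite -chipowM -[LHS]mul1r -X4 -chipowM.
  by congr (X 1 _); field.
rewrite (partition_big (fun u => u ^+ 2) predT) //=.
transitivity (\sum_v (X 1 (1 - v) + X 1 v * X 2 (1 - v))); last first.
  by rewrite big_split /= sum_chipow_1sub // add0r.
transitivity (\sum_v X 1 (1 - v) * (1 + X 2 v)).
  apply: eq_bigr => v _; rewrite -card_sqrt mulr_sumr.
  by apply: eq_bigr => u /eqP->; rewrite mulr1.
under eq_bigr do rewrite mulrDr mulr1.
rewrite !big_split /=; congr (_ + _).
rewrite (reindex_inj (inj_comp (addrI 1) oppr_inj)) /=.
by apply: eq_bigr => v _; rewrite subKr.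
Qed.

(** In the double sum over x and y the substitution x = t y leaves, for each
    fixed t, a sum over y of chi((1 - t y)/(1 - y)), where the argument runs
    over a projective line minus a few points. *)
Lemma norm_jacobi11 : jacobi11 * jacobi11^* = n.
Proof.
have inner t : \sum_y X 0 y * (X 1 (1 - t * y) * X 3 (1 - y)) =
               n * (t == 1)%:R - X 1 t - 1.
  rewrite sum_off0 mulr0 !subr0 !chipow1 mul1r; congr (_ - _).
  rewrite (reindex_inj (inj_comp (addrI 1) (inj_comp oppr_inj invr_inj))) /=.
  transitivity (\sum_r X 0 r * X 1 ((1 - t) * r + t)).
    apply: eq_bigr => r _; rewrite subKr chipowV.
    have [->|r0] := eqVneq r 0; first by rewrite !chipow0 mul0r mulr0.
    have -> : 1 - t * (1 - r^-1) = ((1 - t) * r + t) * r^-1 by field.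
    rewrite chipowM chipowV -mulrA -chipowD.
    by rewrite -(chipow_mod (3 * 1 + 3 * 3)) mulrC.
  rewrite sum_off0 mulr0 add0r; congr (_ - _).
  have [->|t1] := eqVneq t 1.
    by under eq_bigr do rewrite subrr mul0r add0r chipow1; rewrite sum_const1 mulr1.
  have t1' : 1 - t != 0 by rewrite subr_eq0 eq_sym.
  rewrite mulr0; transitivity (\sum_r X 1 r); last exact: sum_chipow.
  by rewrite [RHS](reindex_inj (addIr t)) [RHS](reindex_inj (mulfI t1')).
rewrite {2}/jacobi11 rmorph_sum mulr_sumr.
transitivity (\sum_y \sum_t X 1 t * (X 0 y * (X 1 (1 - t * y) * X 3 (1 - y)))).
  apply: eq_bigr => y _; rewrite rmorphM /= !chipow_conj mulr_suml.
  have [->|y0] := eqVneq y 0.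
    by rewrite !big1 // => t _; rewrite !chipow0 ?(mul0r, mulr0).
  rewrite (reindex_inj (mulIf y0)); apply: eq_bigr => t _ /=.
  rewrite chipowM -(chipow_mod 0) -[(0 %% 4)%N]/((3 * 1 + 1) %% 4)%N.
  by rewrite chipow_mod chipowD; ring.
rewrite exchange_big; under eq_bigr do rewrite -mulr_sumr inner.
transitivity (\sum_t ((t == 1)%:R * n * X 1 t - X 2 t - X 1 t)).
  by apply: eq_bigr => t _; rewrite (chipowD 1 1); ring.
rewrite !sumrB !sum_chipow // !subr0 (bigD1 1) //= eqxx chipow1 mulr1 mul1r.
by rewrite big1 ?addr0 // => t /negPf->; rewrite !mul0r.
Qed.

Definition label_sum (e : seq nat) : algC :=
  config_sum (nth 0 e 0) (nth 0 e 1) (nth 0 e 2) (nth 0 e 3) (nth 0 e 4)%N.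

Lemma label_sum_swap m e : label_sum (swap m e) = label_sum e.
Proof.
case: e => [|e1 [|e2 [|e3 [|e4 [|e5 [|]]]]]]; do 5?[case: m => [|m] //=].
- rewrite [RHS]config_sum_swap_0oo -[LHS]config_sum_mod -[RHS]config_sum_mod /=.
  by rewrite !modn_mod.
- by rewrite [RHS]config_sum_swap_01.
- rewrite [RHS]config_sum_swap_1c -[LHS]config_sum_mod -[RHS]config_sum_mod /=.
  by rewrite !modn_mod.
- by rewrite [RHS]config_sum_swap_bc.
Qed.

Lemma label_sum_orbit e e' : e' \in label_orbit e -> label_sum e' = label_sum e.
Proof.
have scan ms x y : y \in x :: scanl (fun x m => swap m x) x ms ->
    label_sum y = label_sum x.
  elim: ms x => [|m ms IHms] x /=; first by rewrite inE => /eqP->.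
  rewrite inE => /orP[/eqP->//|/IHms->]; exact: label_sum_swap.
rewrite /label_orbit; move: (X in foldl _ _ X) => mss.
have: {in [:: e], forall x, label_sum x = label_sum e}.
  by move=> x; rewrite inE => /eqP->.
elim: mss [:: e] => [|ms mss IHmss] es es_e /=; first exact: es_e.
apply: IHmss => x /flatten_mapP[y y_es /scan ->]; exact: es_e.
Qed.

Lemma label_sum_class_rep e : label_sum (class_rep e) = label_sum e.
Proof.
rewrite /class_rep; case E: [seq r <- _ | _] => [|r rs] //=.
apply: label_sum_orbit; have: r \in r :: rs by rewrite mem_head.
by rewrite -E mem_filter => /andP[].
Qed.

(** At u != 0 this is 1 if chi u is 1 or w, and 0 if chi u is -1 or - w. *)
Definition edge (u : F) : algC :=
  (2%:R * X 0 u + (1 - w) * X 1 u + (1 + w) * X 3 u) / 4%:R.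

Definition edge_coef (k : nat) : algC :=
  if k is 0 then 2%:R else if k is 1 then 1 - w else 1 + w.

Lemma edgeE u :
  edge u = (\sum_(k <- [:: 0; 1; 3]%N) edge_coef k * X k u) / 4%:R.
Proof. by rewrite /edge !big_cons big_nil /edge_coef addr0 addrA. Qed.

Lemma word_coef l : l \in balanced_words ->
  \prod_(k <- l) edge_coef k = (word_weight l)%:~R.
Proof.
rewrite mem_filter => /andP[l4 /mem_words[size_l l_ks]].
have [El Es Ep] : [/\ size l = (count_mem 0 l + count_mem 1 l + count_mem 3 l)%N,
    sumn l = (count_mem 1 l + 3 * count_mem 3 l)%N &
    \prod_(k <- l) edge_coef k = 2%:R ^+ count_mem 0%N l *
      ((1 - w) ^+ count_mem 1%N l * (1 + w) ^+ count_mem 3 l)].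
  elim: l l_ks {l4 size_l} => [|k l IHl] /=; first by rewrite big_nil !mulr1.
  rewrite big_cons => /andP[+ /IHl[-> -> ->]].
  rewrite !inE => /or3P[]/eqP->; split=> /=; try lia;
    by rewrite ?add0n ?exprD ?expr1 /edge_coef /=; ring.
rewrite Ep /word_weight; move: l4 size_l; rewrite El Es.
move: (count_mem 0%N l) (count_mem 1%N l) (count_mem 3 l) => n0 n1 n3.
move=> l4 E.
(* only eight pairs (n1, n3) are balanced and small enough *)
have: (n1 + n3 <= 6)%N by lia.
have: (n1 < 7)%N by lia.
have: (n3 < 7)%N by lia.
have -> : n0 = (6 - (n1 + n3))%N by lia.
move: l4 {E}.
do 7?[case: n1 => [|n1] //]; do 7?[case: n3 => [|n3] //]; move=> _ _ _ // _;
  by rewrite /= ?rmorphM ?rmorphXn /=; ring: w2.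
Qed.

Lemma sum_chipowE k : \sum_a X k a = (n - 1) * (4 %| k)%N%:R.
Proof.
have [k4|k4] := boolP (4 %| k)%N; last by rewrite mulr0 sum_chipow.
rewrite mulr1 -sum_const1 -(chipow1 0) -[X in _ - X](mul1r _).
under eq_bigr => a _ do rewrite -chipow_mod (eqP k4) -[X 0 a]mulr1.
rewrite sum_off0 chipow1 mul1r; congr (_ - _).
Qed.

(** Expanding the six factors gives a character of exponent [sumn l] in the
    scaling variable a, whose sum is n - 1 or 0. *)
Lemma scaled_clique_sum :
  \sum_a \sum_b \sum_c
    \prod_(u <- [:: a; a * b; a * c; a * (1 - b); a * (1 - c); a * (b - c)])
      edge u =
  (n - 1) / 4%:R ^+ 6 *
  \sum_(l <- balanced_words) (word_weight l)%:~R * label_sum (behead l).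
Proof.
transitivity (\sum_(l <- words [:: 0; 1; 3]%N 6)
    4%:R ^- 6 * (\prod_(k <- l) edge_coef k) *
    ((\sum_a X (sumn l) a) * label_sum (behead l))).
  pose G l a b c := 4%:R ^- 6 * (\prod_(k <- l) edge_coef k) * (X (sumn l) a *
    (X (nth 0%N l 1) b * X (nth 0%N l 2) c * X (nth 0%N l 3) (1 - b) *
     X (nth 0%N l 4) (1 - c) * X (nth 0%N l 5) (b - c))).
  transitivity (\sum_a \sum_b \sum_c
      \sum_(l <- words [:: 0; 1; 3]%N 6) G l a b c).
    apply: eq_bigr => a _; apply: eq_bigr => b _; apply: eq_bigr => c _.
    under eq_bigr do rewrite edgeE.
    rewrite big_split /= prod_sum_words mulrC.
    rewrite [X in X * _](_ : _ = 4%:R ^- 6); last first.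
      by rewrite !big_cons big_nil; field.
    rewrite mulr_sumr.
    apply: eq_big_seq => l /mem_words[size_l _]; rewrite /G -mulrA.
    case: l size_l => [|l0 [|l1 [|l2 [|l3 [|l4 [|l5 []]]]]]] // _.
    congr (_ * _); rewrite /= !big_cons !big_nil /= !addn0.
    by rewrite !chipowD !chipowM; ring.
  under eq_bigr do
    (under eq_bigr do rewrite exchange_big; rewrite exchange_big).
  rewrite exchange_big; apply: eq_bigr => l _ /=.
  rewrite mulr_suml mulr_sumr; apply: eq_bigr => a _.
  rewrite !mulr_sumr; apply: eq_bigr => b _; rewrite !mulr_sumr.
  by apply: eq_bigr => c _; rewrite !nth_behead.
rewrite [in RHS]big_filter mulr_sumr [RHS]big_mkcond.
apply: eq_big_seq => l l_w /=.
rewrite sum_chipowE; case: ifP => l4; last by rewrite !(mul0r, mulr0).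
by rewrite -word_coef ?mem_filter ?l4 //= mulr1; field.
Qed.

Lemma edgeN u : edge (- u) = edge u.
Proof. by rewrite /edge !chipowN. Qed.

Lemma edge_sym u v : edge (u - v) = edge (v - u).
Proof. by rewrite -edgeN opprB. Qed.

Lemma edge0 : edge 0 = 0.
Proof. by rewrite /edge !chipow0 !mulr0 !addr0 mul0r. Qed.

(** The points are x, x - a, x - a b and x - a c. *)
Lemma translate_clique_sum :
  \sum_x \sum_y \sum_u \sum_v
    edge (x - y) * edge (x - u) * edge (x - v) *
    edge (y - u) * edge (y - v) * edge (u - v) =
  n * \sum_a \sum_b \sum_c
    \prod_(u <- [:: a; a * b; a * c; a * (1 - b); a * (1 - c); a * (b - c)])
      edge u.
Proof.
rewrite -sum_const1 mulr_suml; apply: eq_bigr => x _; rewrite mul1r.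
rewrite (reindex_inj (inj_comp (addrI x) oppr_inj)); apply: eq_bigr => a _ /=.
have [->|a0] := eqVneq a 0.
  rewrite [RHS]big1 => [|b _]; last first.
    by rewrite big1 // => c _; rewrite big_cons edge0 mul0r.
  by rewrite big1 // => u _; rewrite big1 // => v _; rewrite subKr edge0 !mul0r.
rewrite (reindex_inj (inj_comp (addrI x) (inj_comp oppr_inj (mulfI a0)))).
apply: eq_bigr => b _ /=.
rewrite (reindex_inj (inj_comp (addrI x) (inj_comp oppr_inj (mulfI a0)))).
apply: eq_bigr => c _ /=; rewrite !subKr.
have E s t : edge (x - s - (x - t)) = edge (s - t).
  by rewrite [RHS]edge_sym; congr (edge _); ring.
rewrite !E !big_cons big_nil !mulrBr !mulr1; ring.
Qed.

(** The identities rho = xi and rho * rho^* = n remove the terms linear in the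
    Jacobi sums and turn the real part of rho * xi into n minus squares of
    imaginary parts. *)
Lemma class_sum :
  \sum_(l <- balanced_words) (word_weight l)%:~R * label_sum (behead l) =
  32%:R * (2%:R * (n ^+ 2 - 20%:R * n + 81%:R) + 2%:R * 'Im jacobi11 ^+ 2 +
   4%:R * 'Im jacobi11 * 'Im jacobi12 - 'Re (config_sum 1 1 3 3 1) +
   3%:R * config_sum 1 3 3 1 1).
Proof.
have [reps_ok] := class_weights; set t := total_weight _ => weights.
transitivity (\sum_(r <- class_reps) (t r)%:~R * label_sum r).
  have reps_uniq : uniq class_reps by [].
  rewrite -(sum_total_weight _ label_sum _ _ reps_uniq reps_ok) [RHS]big_map.
  by apply: eq_bigr => l _; rewrite label_sum_class_rep.
move: t weights => t; rewrite /class_reps !big_cons big_nil.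
case; do 13![move=> -> ].
rewrite /label_sum /=.
have conj e1 e2 e3 e4 e5 : config_sum (3 * e1 %% 4) (3 * e2 %% 4)
    (3 * e3 %% 4) (3 * e4 %% 4) (3 * e5 %% 4) = (config_sum e1 e2 e3 e4 e5)^*.
  by rewrite config_sum_conj config_sum_mod.
have c1 : config_sum 0 0 0 2 3 = (config_sum 0 0 0 2 1)^* := conj 0 0 0 2 1%N.
have c2 : config_sum 0 0 3 3 3 = (config_sum 0 0 1 1 1)^* := conj 0 0 1 1 1%N.
have c3 : config_sum 0 3 3 0 3 = (config_sum 0 1 1 0 1)^* := conj 0 1 1 0 1%N.
have c4 : config_sum 3 3 1 1 3 = (config_sum 1 1 3 3 1)^* := conj 1 1 3 3 1%N.
move: c1 c2 c3 c4.
move: config_sum_00000 config_sum_00001 config_sum_00010 config_sum_00021.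
move: config_sum_00110 config_sum_00111 config_sum_01101.
(* with [config_sum] abstract, rewriting does not unfold the sums *)
move: config_sum {conj} => T.
do 3![move=> -> ]; do 4![move=> -> ]; do 4![move=> -> ].
move: jacobi11_eq_jacobi12 norm_jacobi11.
move: (jacobi11) (jacobi12) (#|F|%:R : algC) => r _ N <- <-.
have -> : (1 - r)^* = 1 - r^* by rewrite rmorphB rmorph1.
have -> : (- 2%:R * r)^* = - 2%:R * r^* by rewrite rmorphM rmorphN rmorph_nat.
have -> : (r * r + 1)^* = r^* * r^* + 1 by rewrite rmorphD rmorphM rmorph1.
rewrite ReE !ImE.
have i2 := @sqrCi algC.
by field: i2.
Qed.

Lemma quartic_clique_sum :
  \sum_x \sum_y \sum_u \sum_v
    edge (x - y) * edge (x - u) * edge (x - v) *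
    edge (y - u) * edge (y - v) * edge (u - v) =
  n * (n - 1) / 128%:R *
  (2%:R * (n ^+ 2 - 20%:R * n + 81%:R) + 2%:R * 'Im jacobi11 ^+ 2 +
   4%:R * 'Im jacobi11 * 'Im jacobi12 - 'Re (config_sum 1 1 3 3 1) +
   3%:R * config_sum 1 3 3 1 1).
Proof.
by rewrite translate_clique_sum scaled_clique_sum class_sum; field.
Qed.

End QuarticSums.

(** * Dirichlet characters and hypergeometric sums at 1 *)

Section Dirichlet.

Variable q : nat.
Hypothesis q_gt1 : (1 < q)%N.
Local Notation R := 'Z_q.
Local Notation CF := 'CF(Zunits q).
Local Notation U := (GRing.unit : {pred R}).

Lemma in_Zunits (u : {unit R}) : u \in Zunits q. Proof. by rewrite inE. Qed.

Lemma dirichlet_unit (A : CF) (u : {unit R}) : dirichlet A (val u) = A u.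
Proof. by rewrite /dirichlet valK. Qed.

Lemma dirichlet_nonunit (A : CF) x : x \notin U -> dirichlet A x = 0.
Proof. by move=> xU; rewrite /dirichlet insubF // (negPf xU). Qed.

Lemma unit_val (x : R) : x \in U -> exists u : {unit R}, x = val u.
Proof. by move=> xU; exists (FinRing.Unit xU). Qed.

Lemma dirichletMl (A B : CF) x :
  dirichlet (A * B) x = dirichlet A x * dirichlet B x.
Proof.
have [/unit_val[u ->]|xU] := boolP (x \in U); last first.
  by rewrite !dirichlet_nonunit ?mulr0.
by rewrite !dirichlet_unit cfunE.
Qed.

Lemma dirichlet_exp (A : CF) k x : dirichlet (A ^+ k.+1) x = dirichlet A x ^+ k.+1.
Proof.
by elim: k => [|k IHk]; rewrite ?expr1 // exprS dirichletMl IHk -exprS.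
Qed.

Lemma dirichlet_conj (A : CF) x : dirichlet (A^*)%CF x = (dirichlet A x)^*.
Proof.
have [/unit_val[u ->]|xU] := boolP (x \in U).
  by rewrite !dirichlet_unit cfunE.
by rewrite !dirichlet_nonunit // rmorph0.
Qed.

Section Linear.
Variable A : CF.
Hypothesis A_lin : A \is a linear_char.

Lemma dirichletM x y : dirichlet A (x * y) = dirichlet A x * dirichlet A y.
Proof.
have [/unit_val[u ->]|xU] := boolP (x \in U); last first.
  rewrite (dirichlet_nonunit _ _ xU) dirichlet_nonunit ?mul0r //.
  by rewrite unitrM (negPf xU).
have [/unit_val[v ->]|yU] := boolP (y \in U); last first.
  rewrite (dirichlet_nonunit _ _ yU) dirichlet_nonunit ?mulr0 //.
  by rewrite unitrM (negPf yU) andbF.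
by rewrite -[val u * val v]/(val (u * v)%g) !dirichlet_unit lin_charM ?in_Zunits.
Qed.

Lemma dirichlet1 : dirichlet A 1 = 1.
Proof. by rewrite -[1]/(val (1%g : {unit R})) dirichlet_unit lin_char1. Qed.

Lemma dirichletV x : dirichlet A x^-1 = (dirichlet A x)^*.
Proof.
have [/unit_val[u ->]|xU] := boolP (x \in U); last first.
  by rewrite !dirichlet_nonunit ?unitrV // rmorph0.
by rewrite -[(val u)^-1]/(val (u^-1)%g) !dirichlet_unit lin_charV_conj ?in_Zunits.
Qed.

Lemma dirichletN1_sqr : dirichlet A (-1) ^+ 2 = 1.
Proof. by rewrite expr2 -dirichletM mulrNN mulr1 dirichlet1. Qed.

Lemma dirichletN1_conj : (dirichlet A (-1))^* = dirichlet A (-1).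
Proof. by rewrite -dirichletV invrN1. Qed.

End Linear.

Lemma irr_linear (i : Iirr (Zunits q)) : 'chi_i \is a linear_char.
Proof. by rewrite -irr_Zunits mem_irr. Qed.

Lemma sum_irr_dirichlet x :
  \sum_(i : Iirr (Zunits q)) dirichlet 'chi_i x = (totient q)%:R * (x == 1)%:R.
Proof.
have [/unit_val[u ->]|xU] := boolP (x \in U); last first.
  rewrite big1 => [|i _]; last by rewrite dirichlet_nonunit.
  have [x1|_] := eqVneq x 1; last by rewrite mulr0.
  by move: xU; rewrite x1 unitr1.
have := cfRegE (Zunits q) u; rewrite cfReg_sum sum_cfunE.
rewrite -(card_units_Zp (ltnW q_gt1)) mulr_natr -(inj_eq val_inj) /= => <-.
apply: eq_bigr => i _; rewrite dirichlet_unit cfunE.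
by rewrite lin_char1 ?irr_linear // mul1r.
Qed.

(** Summing over the characters by orthogonality leaves the x, y, t with
    - x y t = (1 - x)(1 - y)(1 - t), all factors being units.  This equation is
    t s = (1 - x)(1 - y) with s = 1 - x - y, so it determines t, and
    (1 - t) s = - x y. *)
Lemma hyp3F2_1 (A B C D E : CF) :
    A \is a linear_char -> B \is a linear_char -> C \is a linear_char ->
    D \is a linear_char -> E \is a linear_char ->
  q%:R ^+ 2 * hyp3F2 A B C D E 1 = dirichlet D (-1) * \sum_x \sum_y
    dirichlet (A * (E^*)%CF) x * dirichlet (B * (E^*)%CF) y * dirichlet C (1 - x) *
    dirichlet (C * (D^*)%CF) (1 - y) * dirichlet (E * (C^*)%CF) (1 - x - y).
Proof.
move=> A_lin B_lin C_lin D_lin E_lin.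
have q0 : (q%:R : algC) != 0 by rewrite pnatr_eq0 -lt0n ltnW.
have t0 : ((totient q)%:R : algC) != 0 by rewrite pnatr_eq0 -lt0n totient_gt0 ltnW.
pose P x y t := dirichlet A x * dirichlet B y * dirichlet C t *
  (dirichlet D (1 - y))^* * (dirichlet E (1 - t))^*.
pose v x y t : R := (1 - x) * (1 - y) * (1 - t).
transitivity (dirichlet D (-1) * dirichlet E (-1) *
  \sum_x \sum_y \sum_t
    P x y t * ((v x y t \in U) && (- (x * y * t) == v x y t))%:R).
  pose Q i x y t := P x y t * (dirichlet 'chi[Zunits q]_i (- (x * y * t)) *
    (dirichlet 'chi_i (v x y t))^*).
  transitivity ((totient q)%:R^-1 * \sum_i
    dirichlet D (-1) * dirichlet E (-1) * \sum_x \sum_y \sum_t Q i x y t).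
    rewrite /hyp3F2 2!mulrA [in RHS]mulr_sumr mulr_sumr; apply: eq_bigr => i _.
    have i_lin := irr_linear i.
    have iN1 := dirichletN1_sqr _ i_lin.
    rewrite dirichlet1 // mulr1 /char_binom !dirichletMl.
    transitivity ((totient q)%:R^-1 * (dirichlet D (-1) * dirichlet E (-1) *
       (dirichlet 'chi_i (-1) * (jacobi (A * 'chi_i) (('chi_i)^*)%CF *
          jacobi (B * 'chi_i) ((D * 'chi_i)^*)%CF *
          jacobi (C * 'chi_i) ((E * 'chi_i)^*)%CF)))).
      by field: iN1; rewrite q0 t0.
    congr (_ * (_ * _)); rewrite /jacobi big_distrlr /= mulr_suml mulr_sumr.
    apply: eq_bigr => x _; rewrite mulr_suml mulr_sumr.
    apply: eq_bigr => y _; rewrite !mulr_sumr; apply: eq_bigr => t _.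
    rewrite !dirichlet_conj !dirichletMl /Q /P /v -[- (x * y * t)]mulN1r.
    rewrite !dirichletM //.
    rewrite !rmorphM /=; ring.
  rewrite -mulr_sumr mulrCA; congr (_ * _).
  rewrite exchange_big mulr_sumr; apply: eq_bigr => x _.
  rewrite exchange_big mulr_sumr; apply: eq_bigr => y _.
  rewrite exchange_big mulr_sumr; apply: eq_bigr => t _.
  rewrite -mulr_sumr mulrCA; congr (_ * _).
  under eq_bigr => i _ do
    rewrite -dirichletV ?irr_linear // -dirichletM ?irr_linear //.
  rewrite sum_irr_dirichlet mulKf //; congr (nat_of_bool _)%:R.
  have [vU|vU] := boolP (v x y t \in U).
    by rewrite -(inj_eq (mulIr vU)) divrK // mul1r.
  apply/eqP => E1; move: vU; rewrite -unitrV.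
  have: - (x * y * t) * (v x y t)^-1 \in U by rewrite E1 unitr1.
  by rewrite unitrM => /andP[_ ->].
rewrite -mulrA; congr (_ * _); rewrite mulr_sumr; apply: eq_bigr => x _.
rewrite mulr_sumr; apply: eq_bigr => y _.
rewrite !dirichletMl !dirichlet_conj.
pose s : R := 1 - x - y.
have key t : - (x * y * t) == v x y t = (t * s == (1 - x) * (1 - y)).
  rewrite -subr_eq0 -[RHS]subr_eq0.
  by congr (_ == _); rewrite /v /s; ring.
have [|bad] := boolP [&& x \in U, y \in U, 1 - x \in U, 1 - y \in U & s \in U].
  case/and5P => xU yU x1U y1U sU.
  pose t0' := (1 - x) * (1 - y) * s^-1.
  have t1 : 1 - t0' = - (x * y) * s^-1.
    by apply: (mulIr sU); rewrite mulrBl !divrK // /s; ring.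
  rewrite (bigD1 t0') //= big1 ?addr0 => [|t tt0].
    rewrite key divrK // eqxx andbT /v t1 !unitrM x1U y1U.
    rewrite unitrN unitrM xU yU unitrV sU mulr1.
    rewrite /P t1 /t0' -[- (x * y)]mulN1r !dirichletM // !dirichletV //.
    rewrite !rmorphM /= conjCK dirichletN1_conj //.
    have EN := dirichletN1_sqr _ E_lin; ring: EN.
  rewrite key; case: eqP => [E1|_]; last by rewrite andbF mulr0.
  by case/eqP: tt0; rewrite /t0' -E1 mulrK.
rewrite big1 ?mulr0 => [|t _].
  symmetry; move: bad; do 4?[case/nandP]; rewrite -/s => /dirichlet_nonunit Z;
  by rewrite !Z ?(mul0r, mulr0, rmorph0).
case: andP => [[vU b]|]; last by rewrite mulr0.
case/negP: bad; move: (b) (b); rewrite {1}key => /eqP ts /eqP xyt.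
have: - (x * y * t) \in U by rewrite xyt.
have: t * s \in U by rewrite ts; move: vU; rewrite /v unitrM => /andP[].
move: vU; rewrite /v unitrN !unitrM => /andP[/andP[-> ->] _] /andP[_ ->].
by case/andP=> /andP[-> ->].
Qed.

(** * Reduction modulo p *)

Section Reduction.

Variables (p alpha : nat).
Hypotheses (p_prime : prime p) (alpha_gt0 : (0 < alpha)%N) (qE : q = (p ^ alpha)%N).
Local Notation K := (p ^ alpha.-1)%N.

Definition modp (x : R) : 'F_p := (val x)%:R.
Definition of_modp (a : 'F_p) : R := (val a)%:R.

Lemma Zq_cast : (Zp_trunc q).+2 = q. Proof. exact: Zp_cast. Qed.

Lemma p_dvd_q : (p %| q)%N. Proof. by rewrite qE dvdn_exp. Qed.

Lemma modp_nat k : modp (k%:R) = k%:R.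
Proof.
rewrite /modp /= val_Zp_nat // -(Fp_nat_mod p_prime) modn_dvdm ?p_dvd_q //.
by rewrite Fp_nat_mod.
Qed.

Lemma modpD x y : modp (x + y) = modp x + modp y.
Proof. by rewrite -{1}(natr_Zp x) -{1}(natr_Zp y) -natrD modp_nat natrD. Qed.

Lemma modpM x y : modp (x * y) = modp x * modp y.
Proof. by rewrite -{1}(natr_Zp x) -{1}(natr_Zp y) -natrM modp_nat natrM. Qed.

Lemma modp1 : modp 1 = 1. Proof. exact: (modp_nat 1). Qed.
Lemma modp0 : modp 0 = 0. Proof. exact: (modp_nat 0). Qed.

Lemma modpB x y : modp (x - y) = modp x - modp y.
Proof. by apply/(canRL (addrK _)); rewrite -modpD subrK. Qed.

Lemma modpX x k : modp (x ^+ k) = modp x ^+ k.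
Proof. by elim: k => [|k IHk]; rewrite ?modp1 // !exprS modpM IHk. Qed.

Lemma of_modpK a : modp (of_modp a) = a.
Proof. by rewrite /of_modp modp_nat natr_Zp. Qed.

Lemma modp_eq0 x : (modp x == 0) = (x \notin U).
Proof.
rewrite -(natr_Zp x) modp_nat; move: (nat_of_ord x) => k.
rewrite unitZpE // qE coprime_pexpl //.
by rewrite prime_coprime // negbK -(dvdn_pcharf (pchar_Fp p_prime)).
Qed.

Lemma card_fiber a : #|[set x | modp x == a]| = K.
Proof.
have same b : #|[set x | modp x == b]| = #|[set x | modp x == 0]|.
  rewrite -(card_imset _ (addrI (- of_modp b))); apply: eq_card => x.
  rewrite [in RHS]inE; apply/imsetP/eqP => [[y] | x0].
    by rewrite inE => /eqP yb ->; rewrite addrC modpB of_modpK yb subrr.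
  exists (x + of_modp b); last by rewrite addrC addrK.
  by rewrite inE modpD x0 of_modpK add0r.
have: (#|[set x | modp x == 0%R]| * p = q)%N.
  have cR : #|{: R}| = q by rewrite card_ord Zq_cast.
  rewrite -[RHS]cR -[RHS]sum1_card [RHS](partition_big modp predT) //=.
  rewrite [RHS](eq_bigr (fun=> #|[set x | modp x == 0%R]|)) => [|b _]; last first.
    by rewrite -(same b) -sum1_card; apply: eq_bigl => x; rewrite inE.
  by rewrite sum_nat_const mulnC cardT -cardE card_Fp.
rewrite same; move: #|_| => m; rewrite qE -{1}(prednK alpha_gt0) expnSr.
by move/eqP; rewrite eqn_pmul2r ?prime_gt0 // => /eqP.
Qed.

Lemma sum_modp (h : 'F_p -> algC) : \sum_x h (modp x) = K%:R * \sum_a h a.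
Proof.
rewrite (partition_big modp predT) //= mulr_sumr; apply: eq_bigr => a _.
rewrite (eq_bigr (fun=> h a)) => [|x /eqP-> //].
rewrite sumr_const -(card_fiber a) mulr_natl; congr (_ *+ _).
by apply: eq_card => x; rewrite inE.
Qed.


Hypothesis p_mod8 : (p = 1 %[mod 8])%N.
Variable g : {unit R}.
Hypothesis g_gen : generator (Zunits q) g.
Variable chi4 : CF.
Hypotheses (chi4_lin : chi4 \is a linear_char) (chi4_order : #[chi4]%CF = 4%N).
Local Notation w := (chi4 g).

Lemma unit_pow_gen (u : {unit R}) : exists k, u = (g ^+ k)%g.
Proof.
have : u \in Zunits q by rewrite in_Zunits.
by rewrite (eqP g_gen) => /cycleP[k ->]; exists k.
Qed.

Lemma chi4_pow_gen k : chi4 (g ^+ k)%g = w ^+ k.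
Proof. by rewrite lin_charX ?in_Zunits. Qed.

Lemma chi4X4 (u : {unit R}) : chi4 u ^+ 4 = 1.
Proof.
have := exp_cforder chi4; rewrite chi4_order => /(congr1 (fun phi : CF => phi u)).
rewrite -lin_charX ?in_Zunits // !expgS !lin_charM ?in_Zunits //.
by rewrite exprS !cfunE /= cfun1E in_Zunits lin_char1 // !mulr1.
Qed.

Lemma w_sqr : w ^+ 2 = -1.
Proof.
have /eqP: (w ^+ 2) ^+ 2 = 1 by rewrite -exprM chi4X4.
rewrite sqrf_eq1 => /orP[/eqP w2|/eqP->//].
have : (#[chi4]%CF %| 2)%N.
  rewrite dvdn_cforder; apply/eqP/cfun_inP => u _.
  have [k ->] := unit_pow_gen u.
  rewrite expr2 cfunE cfun1E in_Zunits chi4_pow_gen -expr2 -exprM mulnC exprM w2.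
  by rewrite expr1n.
by rewrite chi4_order.
Qed.

Lemma K_mod4 : (K %% 4 = 1)%N.
Proof.
have -> : (4 = 2 * 2)%N by [].
have p4 : (p = 1 %[mod 4])%N.
  by rewrite -(@modn_dvdm 8 p 4) // p_mod8.
by rewrite -modnXm p4 modnXm exp1n.
Qed.

(** The kernel H has order K, and K = 1 mod 4, so chi4 u = chi4 (u ^+ K). *)
Lemma chi4_kernel (u : {unit R}) : modp (val u) = 1 -> chi4 u = 1.
Proof.
move=> u1; pose H := [set v : {unit R} | modp (val v) == 1].
have H_group : group_set H.
  apply/group_setP; split=> [|v1 v2]; first by rewrite inE modp1.
  by rewrite !inE /= modpM => /eqP-> /eqP->; rewrite mulr1.
have H_card : #|H| = K.
  rewrite -(card_fiber 1) -(card_imset H val_inj); apply: eq_card => x.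
  rewrite inE; apply/imsetP/eqP => [[v]|x1]; first by rewrite inE => /eqP v1 ->.
  have /unit_val[v xv] : x \in U by rewrite -[_ \in _]negbK -modp_eq0 x1 oner_eq0.
  by exists v; rewrite // inE -xv x1.
have uK : (u ^+ K)%g = 1%g.
  by rewrite -H_card; apply: (@expg_cardG _ (Group H_group)); rewrite inE u1.
rewrite -(lin_char1 chi4_lin) -uK lin_charX ?in_Zunits //.
by rewrite (divn_eq K 4) K_mod4 exprD mulnC exprM chi4X4 expr1n mul1r.
Qed.

Definition chiF (a : 'F_p) : algC := dirichlet chi4 (of_modp a).

Lemma dirichlet_modp x : dirichlet chi4 x = chiF (modp x).
Proof.
rewrite /chiF; have E : modp (of_modp (modp x)) = modp x by rewrite of_modpK.
have [xU|xU] := boolP (x \in U); last first.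
  by rewrite !dirichlet_nonunit // -modp_eq0 E modp_eq0.
have yU : of_modp (modp x) \in U by rewrite -[_ \in _]negbK -modp_eq0 E modp_eq0 xU.
move: E yU; move: (of_modp _) => y E yU.
have [/unit_val[u xu] /unit_val[v yv]] := (xU, yU).
have u1 : modp (val (u * v^-1)%g) = 1.
  apply: (@mulIf _ (modp y)); first by rewrite modp_eq0 yU.
  have uvy : val (u * v^-1)%g * y = x by rewrite yv xu /= divrK // (valP v).
  by rewrite -modpM uvy mul1r E.
have := chi4_kernel _ u1; rewrite xu yv !dirichlet_unit.
rewrite lin_charM ?in_Zunits // => /(congr1 (fun t => t * chi4 v)).
by rewrite mul1r -mulrA -lin_charM ?in_Zunits // mulVg lin_char1 // mulr1.
Qed.

Lemma chiF_M : {morph chiF : a b / a * b}.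
Proof.
move=> a b; rewrite -{1}(of_modpK a) -{1}(of_modpK b) -modpM -dirichlet_modp.
exact: dirichletM.
Qed.

Lemma of_modp_unit a : a != 0 -> of_modp a \in U.
Proof. by move=> a0; rewrite -[_ \in _]negbK -modp_eq0 of_modpK. Qed.

Lemma chiF_X4 a : a != 0 -> chiF a ^+ 4 = 1.
Proof.
move=> /of_modp_unit/unit_val[u E]; by rewrite /chiF E dirichlet_unit chi4X4.
Qed.

Lemma chiF_g : chiF (modp (val g)) = w.
Proof. by rewrite -dirichlet_modp dirichlet_unit. Qed.

Lemma p_gt2 : (2 < p)%N.
Proof. by case: p p_prime p_mod8 => [|[|[|]]]. Qed.

Lemma two_neq0_Fp : 2%:R != 0 :> 'F_p.
Proof.
rewrite -(dvdn_pcharf (pchar_Fp p_prime)) gtnNdvd ?p_gt2 //.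
Qed.

(** As (-1)^2 = 1, the exponent of -1 = g^k is a multiple of half of the order
    K (p - 1) of g, hence of 4. *)
Lemma exists_root_Xn4D1 : exists z : 'F_p, z ^+ 4 = -1.
Proof.
have [k gk] : exists k, -1 = val (g ^+ k)%g.
  have /unit_val[u ->] : (-1 : R) \in U by rewrite unitrN1.
  by have [k ->] := unit_pow_gen u; exists k.
have ordg : #[g]%g = (K * p.-1)%N.
  rewrite orderE -(eqP g_gen) card_units_Zp ?(ltnW q_gt1) // qE.
  by rewrite totient_pfactor // mulnC.
have : (#[g]%g %| 2 * k)%N.
  rewrite order_dvdn mul2n -addnn expgD; apply/eqP/val_inj => /=.
  by rewrite -gk mulrNN mulr1.
rewrite ordg => d.
have d8 : (8 %| p.-1)%N.
  by rewrite -subn1 -eqn_mod_dvd ?prime_gt0 //; apply/eqP; rewrite p_mod8.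
have /dvdnP[m km] : (4 %| k)%N.
  have: (2 * 4 %| 2 * k)%N by apply: dvdn_trans d; rewrite dvdn_mull.
  by rewrite dvdn_pmul2l.
exists (modp (val (g ^+ m)%g)); rewrite -modpX.
have -> : (val (g ^+ m)%g : R) ^+ 4 = -1.
  by rewrite -FinRing.val_unitX -expgM -km.
by rewrite -sub0r modpB modp0 modp1 sub0r.
Qed.


Local Notation X := (chipow _ chiF).
Local Notation J := (config_sum _ chiF).

Lemma dirichlet_chipow (psi : CF) k x :
    (forall u, psi u = chi4 u ^+ k) -> dirichlet psi x = X k (modp x).
Proof.
move=> psiE; rewrite /chipow modp_eq0; case: ifPn => [|/negbNE] xU.
  exact: dirichlet_nonunit.
rewrite -dirichlet_modp; have [u ->] := unit_val _ xU.
by rewrite !dirichlet_unit psiE.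
Qed.

Lemma chi4_conj (u : {unit R}) : (chi4 u)^* = chi4 u ^+ 3.
Proof.
have c0 : chi4 u != 0 by rewrite lin_char_neq0 ?in_Zunits.
rewrite -lin_charV_conj ?in_Zunits // lin_charV ?in_Zunits //.
by apply: (mulfI c0); rewrite divff // -exprS chi4X4.
Qed.

Lemma mem_fourth_powers (u : {unit R}) : (u \in <[g ^+ 4]>%g) = (chi4 u == 1).
Proof.
apply/cycleP/eqP => [[j ->]|].
  rewrite -expgM chi4_pow_gen exprM -chi4_pow_gen lin_charX ?in_Zunits //.
  by rewrite chi4X4 expr1n.
have [k ->] := unit_pow_gen u; rewrite chi4_pow_gen => wk.
have /dvdnP[m ->] : (4 %| k)%N by apply: contra_eqT wk; exact: w_pow_neq1 w_sqr _.
by exists m; rewrite mulnC expgM.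
Qed.

(** As chi4 (g ^ k) = w ^ k, the fourth powers form the kernel of chi4, and
    their translate by g is the set where chi4 takes the value w. *)
Lemma peisert_indicator x y :
  (peisert_like g x y)%:R = edge _ chiF w (modp x - modp y).
Proof.
rewrite -modpB /peisert_like; move: (x - y) => s.
have [/unit_val[u ->]|sU] := boolP (s \in U); last first.
  have /eqP-> : modp s == 0 by rewrite modp_eq0.
  rewrite edge0; case: imsetP => // -[u _ su].
  by case/negP: sU; rewrite su (valP u).
have Xu k : X k (modp (val u)) = chi4 u ^+ k.
  by rewrite /chipow modp_eq0 (valP u) -dirichlet_modp dirichlet_unit.
rewrite mem_imset; last exact: val_inj.
rewrite inE mem_lcoset !mem_fourth_powers /edge !Xu.
have -> : (chi4 (g^-1 * u)%g == 1) = (chi4 u == w).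
  have w0 : w != 0 by rewrite lin_char_neq0 ?in_Zunits.
  rewrite lin_charM ?lin_charV ?in_Zunits // -(inj_eq (mulfI w0)).
  by rewrite mulVKf // mulr1.
have := chi4X4 u; move: (chi4 u) => v v4.
have [->|v1] := eqVneq v 1; first by rewrite /=; field.
have [->|vw] := eqVneq v w; first by rewrite /=; field: w_sqr.
have /eqP: (v ^+ 2) ^+ 2 = 1 by rewrite -exprM.
rewrite sqrf_eq1 -w_sqr eqf_sqr (negPf vw) sqrf_eq1 (negPf v1) /=.
by case/orP => /eqP-> /=; field: w_sqr.
Qed.

Lemma sum2_modp (h : 'F_p -> 'F_p -> algC) :
  \sum_x \sum_y h (modp x) (modp y) = K%:R ^+ 2 * \sum_a \sum_b h a b.
Proof.
under eq_bigr do rewrite (sum_modp (h _)).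
rewrite (sum_modp (fun a => K%:R * \sum_b h a b)) expr2 -mulrA; congr (_ * _).
by rewrite mulr_sumr.
Qed.

Lemma peisert_clique_sum :
  24%:R * (num_cliques (peisert_like g) 4)%:R = K%:R ^+ 4 *
  \sum_x \sum_y \sum_u \sum_v
    edge _ chiF w (x - y) * edge _ chiF w (x - u) * edge _ chiF w (x - v) *
    edge _ chiF w (y - u) * edge _ chiF w (y - v) * edge _ chiF w (u - v).
Proof.
have [z z4] := exists_root_Xn4D1.
have b_inj (b1 b2 : bool) : b1%:R = b2%:R :> algC -> b1 = b2.
  by case: b1 b2 => [] [] // /eqP; rewrite ?oner_eq0 // eq_sym oner_eq0.
have e_sym : symmetric (peisert_like g).
  move=> x y; apply: b_inj; rewrite !peisert_indicator.
  exact: (edge_sym _ _ chiF_M chiF_X4 z z4).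
have e_irr : irreflexive (peisert_like g).
  by move=> x; apply: b_inj; rewrite peisert_indicator subrr edge0.
pose h a b c d :=
  edge _ chiF w (a - b) * edge _ chiF w (a - c) * edge _ chiF w (a - d) *
  edge _ chiF w (b - c) * edge _ chiF w (b - d) * edge _ chiF w (c - d).
rewrite -natrM num_cliques4 // natr_sum.
transitivity (\sum_x \sum_y K%:R ^+ 2 * \sum_c \sum_d h (modp x) (modp y) c d).
  apply: eq_bigr => x _; rewrite natr_sum; apply: eq_bigr => y _.
  rewrite -(sum2_modp (h _ _)) natr_sum; apply: eq_bigr => u _; rewrite natr_sum.
  by apply: eq_bigr => v _; rewrite !natrM !peisert_indicator.
rewrite (sum2_modp (fun a b => K%:R ^+ 2 * \sum_c \sum_d h a b c d)).
rewrite -[4%N]/(2 + 2)%N exprD -mulrA; congr (_ * _).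
by rewrite mulr_sumr; apply: eq_bigr => a _; rewrite mulr_sumr.
Qed.

Lemma jacobi_modp (A B : CF) i j :
    (forall u, A u = chi4 u ^+ i) -> (forall u, B u = chi4 u ^+ j) ->
  jacobi A B = K%:R * \sum_a X i a * X j (1 - a).
Proof.
move=> AE BE; rewrite -(sum_modp (fun a => X i a * X j (1 - a))).
apply: eq_bigr => x _.
by rewrite (dirichlet_chipow _ _ _ AE) (dirichlet_chipow _ _ _ BE) modpB modp1.
Qed.

(** The second variable y of the hypergeometric side is 1 - c. *)
Lemma sum_config_modp e1 e2 e3 e4 e5 :
  \sum_x \sum_y X e1 (modp x) * X e4 (modp y) * X e3 (modp (1 - x)) *
     X e2 (modp (1 - y)) * X e5 (modp (1 - x - y)) =
  K%:R ^+ 2 * J e1 e2 e3 e4 e5.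
Proof.
have [z z4] := exists_root_Xn4D1.
pose h a b := X e1 a * X e4 b * X e3 (1 - a) * X e2 (1 - b) * X e5 (1 - a - b).
transitivity (\sum_x \sum_y h (modp x) (modp y)).
  by apply: eq_bigr => x _; apply: eq_bigr => y _; rewrite !modpB modp1.
rewrite sum2_modp; congr (_ * _); apply: eq_bigr => a _.
rewrite (reindex_inj (inj_comp (addrI 1) oppr_inj)); apply: eq_bigr => c _ /=.
rewrite /h subKr (chipowB _ _ chiF_M chiF_X4 z z4 _ a c).
have -> : 1 - a - (1 - c) = c - a by ring.
ring.
Qed.


Lemma hyp3F2_config_sum (A B C D E : CF) a b c d e :
    A \is a linear_char -> B \is a linear_char -> C \is a linear_char ->
    D \is a linear_char -> E \is a linear_char ->
    (forall u, A u = chi4 u ^+ a) -> (forall u, B u = chi4 u ^+ b) ->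
    (forall u, C u = chi4 u ^+ c) -> (forall u, D u = chi4 u ^+ d) ->
    (forall u, E u = chi4 u ^+ e) ->
  q%:R ^+ 2 * hyp3F2 A B C D E 1 = dirichlet D (-1) *
    (K%:R ^+ 2 * J (a + 3 * e) (c + 3 * d) c (b + 3 * e) (e + 3 * c)).
Proof.
move=> A_lin B_lin C_lin D_lin E_lin AE BE CE DE EE.
have twist (V W : CF) i j : (forall u, V u = chi4 u ^+ i) ->
    (forall u, W u = chi4 u ^+ j) ->
    forall u, (V * (W^*)%CF) u = chi4 u ^+ (i + 3 * j).
  by move=> VE WE u; rewrite !cfunE VE WE rmorphXn /= chi4_conj -exprM exprD.
rewrite hyp3F2_1 // -sum_config_modp; congr (_ * _).
apply: eq_bigr => x _; apply: eq_bigr => y _.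
rewrite (dirichlet_chipow _ _ _ (twist _ _ _ _ AE EE)).
rewrite (dirichlet_chipow _ _ _ (twist _ _ _ _ BE EE)).
rewrite (dirichlet_chipow _ _ _ CE) (dirichlet_chipow _ _ _ (twist _ _ _ _ CE DE)).
by rewrite (dirichlet_chipow _ _ _ (twist _ _ _ _ EE CE)).
Qed.

Lemma peisert_cliques :
  24%:R * (num_cliques (peisert_like g) 4)%:R = K%:R ^+ 4 *
  (p%:R * (p%:R - 1) / 128%:R *
   (2%:R * (p%:R ^+ 2 - 20%:R * p%:R + 81%:R) +
    2%:R * 'Im (jacobi11 _ chiF) ^+ 2 +
    4%:R * 'Im (jacobi11 _ chiF) * 'Im (jacobi12 _ chiF) -
    'Re (J 1 1 3 3 1) + 3%:R * J 1 3 3 1 1)).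
Proof.
have [z z4] := exists_root_Xn4D1.
rewrite peisert_clique_sum.
rewrite (quartic_clique_sum _ _ chiF_M chiF_X4 z z4 two_neq0_Fp w w_sqr _ chiF_g).
by rewrite card_Fp.
Qed.

Lemma chi4E1 u : chi4 u = chi4 u ^+ 1. Proof. by rewrite expr1. Qed.

Lemma chi4E2 u : (chi4 ^+ 2) u = chi4 u ^+ 2.
Proof. by rewrite !expr2 cfunE. Qed.

Lemma chi4E3 u : (chi4^*)%CF u = chi4 u ^+ 3.
Proof. by rewrite cfunE /= chi4_conj. Qed.

Lemma chi4E0 u : (1 : CF) u = chi4 u ^+ 0.
Proof. by rewrite cfun1E in_Zunits. Qed.

Lemma hyp3F2_M3 :
  q%:R ^+ 2 * hyp3F2 chi4 (chi4^*)%CF (chi4^*)%CF (chi4 ^+ 2) 1 1 =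
  K%:R ^+ 2 * J 1 1 3 3 1.
Proof.
have conj_lin : (chi4^*)%CF \is a linear_char by rewrite cfAut_lin_char.
have sqr_lin : chi4 ^+ 2 \is a linear_char by rewrite rpredX.
have one_lin : (1 : CF) \is a linear_char by exact: cfun1_lin_char.
rewrite (hyp3F2_config_sum _ _ _ _ _ _ _ _ _ _ chi4_lin conj_lin conj_lin
  sqr_lin one_lin chi4E1 chi4E3 chi4E3 chi4E2 chi4E0).
by rewrite dirichlet_exp dirichletN1_sqr // mul1r -(config_sum_mod _ _ chiF_X4).
Qed.

Lemma hyp3F2_M5 :
  q%:R ^+ 2 * hyp3F2 chi4 chi4 (chi4^*)%CF 1 1 1 = K%:R ^+ 2 * J 1 3 3 1 1.
Proof.
have conj_lin : (chi4^*)%CF \is a linear_char by rewrite cfAut_lin_char.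
have one_lin : (1 : CF) \is a linear_char by exact: cfun1_lin_char.
rewrite (hyp3F2_config_sum _ _ _ _ _ _ _ _ _ _ chi4_lin chi4_lin conj_lin
  one_lin one_lin chi4E1 chi4E1 chi4E3 chi4E0 chi4E0).
have [u ->] := unit_val _ (unitrN1 R).
by rewrite dirichlet_unit cfun1E in_Zunits mul1r -(config_sum_mod _ _ chiF_X4).
Qed.

End Reduction.

End Dirichlet.

Theorem theorem3p2 (p alpha : nat) (p_prime : prime p)
    (p_mod8 : (p = 1 %[mod 8])%N) (alpha_gt0 : (0 < alpha)%N)
    (g : {unit 'Z_(p ^ alpha)}) (g_gen : generator (Zunits (p ^ alpha)) g)
    (chi4 : 'CF(Zunits (p ^ alpha))) (chi4_lin : chi4 \is a linear_char)
    (chi4_order : #[chi4]%CF = 4%N) :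
  let q := (p ^ alpha)%N in
  let phi : 'CF(Zunits q) := chi4 ^+ 2 in
  let eps : 'CF(Zunits q) := 1 in
  let rho := jacobi chi4 chi4 in
  let xi := jacobi chi4 phi in
  let M3 := q%:R ^+ 2 * hyp3F2 chi4 (chi4^*)%CF (chi4^*)%CF phi eps 1 in
  let M5 := q%:R ^+ 2 * hyp3F2 chi4 chi4 (chi4^*)%CF eps eps 1 in
  (num_cliques (peisert_like g) 4)%:R =
    p%:R ^+ (2 * alpha - 1) * (p%:R - 1) / 3072%:R *
    (2%:R * p%:R ^+ (2 * alpha - 2) * (p%:R ^+ 2 - 20%:R * p%:R + 81%:R)
     + 2%:R * 'Im rho ^+ 2 + 4%:R * 'Im rho * 'Im xi
     - 'Re M3 + 3%:R * M5) :> algC.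
Proof.
have q_gt1 : (1 < p ^ alpha)%N by rewrite -(exp1n alpha) ltn_exp2r ?prime_gt1.
move=> q phi eps rho xi M3 M5; pose K : algC := (p ^ alpha.-1)%:R.
have rhoE : rho = K * jacobi11 _ (chiF q p chi4).
  by apply: jacobi_modp => // u; exact: chi4E1.
have xiE : xi = K * jacobi12 _ (chiF q p chi4).
  by apply: jacobi_modp => // u; first [exact: chi4E1 | exact: chi4E2].
have M3E : M3 = K ^+ 2 * config_sum _ (chiF q p chi4) 1 1 3 3 1.
  exact: (hyp3F2_M3 _ q_gt1 _ _ p_prime alpha_gt0 _ p_mod8 _ g_gen).
have M5E : M5 = K ^+ 2 * config_sum _ (chiF q p chi4) 1 3 3 1 1.
  exact: (hyp3F2_M5 _ q_gt1 _ _ p_prime alpha_gt0 _ p_mod8 _ g_gen).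
have KR : K^* = K by rewrite rmorph_nat.
have ReM3 : 'Re M3 = K ^+ 2 * 'Re (config_sum _ (chiF q p chi4) 1 1 3 3 1).
  by rewrite M3E !ReE expr2 !rmorphM /= KR -mulrDr -mulrA.
have := peisert_cliques _ q_gt1 _ _ p_prime alpha_gt0 (erefl q) p_mod8 _ g_gen
  _ chi4_lin chi4_order.
rewrite ReM3 M5E rhoE xiE !ImE !rmorphM /= KR.
have -> : p%:R ^+ (2 * alpha - 2) = K ^+ 2 :> algC.
  by rewrite /K natrX -exprM; congr (_ ^+ _); lia.
have -> : p%:R ^+ (2 * alpha - 1) = K ^+ 2 * p%:R :> algC.
  by rewrite /K natrX -exprM -exprSr; congr (_ ^+ _); lia.
move=> cliques24; have n24 : (24%:R : algC) != 0 by rewrite pnatr_eq0.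
by apply: (mulfI n24); rewrite cliques24; field.
Qed.
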